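(* Let $\mathcal{A}$ be an associative conformal algebra, $M$ a conformal $\mathcal{A}$-bimodule, and $T:M\to\mathcal{A}$ an $\mathcal{O}$-operator. Let $M_{ass}=(M,\star_\lambda)$ be the associative conformal algebra with $m\star_\lambda n=T(m)_\lambda n+m_\lambda T(n)$ for $m,n\in M$. Then $\mathcal{A}$ becomes a conformal $M_{ass}$-bimodule by the $\lambda$-actions $$m\cdot_\lambda a=T(m)_\lambda a-T(m_\lambda a),\qquad a\cdot_\lambda m=a_\lambda T(m)-T(a_\lambda m),\qquad m\in M_{ass},\ a\in\mathcal{A}.$$
   Context: All vector spaces are over $\mathbb{C}$. For $\mathbb{C}[\partial]$-modules $U,V,W$, a $\mathbb{C}$-bilinear map $U\times V\to W[\lambda]$, $(u,v)\mapsto u_\lambda v$, is conformal sesquilinear if $(\partial u)_\lambda v=-\lambda\, u_\lambda v$ and $u_\lambda(\partial v)=(\partial+\lambda)(u_\lambda v)$. Maps are extended coefficientwise to polynomials. An associative conformal algebra is a $\mathbb{C}[\partial]$-module $\mathcal{A}$ with a conformal sesquilinear map $(a,b)\mapsto a_\lambda b\in\mathcal{A}[\lambda]$ with $(a_\lambda b)_{\lambda+\mu}c=a_\lambda(b_\mu c)$. A conformal $\mathcal{A}$-bimodule is a $\mathbb{C}[\partial]$-module $M$ with conformal sesquilinear maps $(a,m)\mapsto a_\lambda m\in M[\lambda]$ and $(m,a)\mapsto m_\lambda a\in M[\lambda]$ such that $(a_\lambda b)_{\lambda+\mu}m=a_\lambda(b_\mu m)$, $(m_\lambda a)_{\lambda+\mu}b=m_\lambda(a_\mu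 b)$, $(a_\lambda m)_{\lambda+\mu}b=a_\lambda(m_\mu b)$. An $\mathcal{O}$-operator on $\mathcal{A}$ with respect to $M$ is a $\mathbb{C}[\partial]$-module homomorphism $T:M\to\mathcal{A}$ with $T(m)_\lambda T(n)=T(T(m)_\lambda n+m_\lambda T(n))$ for all $m,n\in M$. It is known that for such $T$, $(M,\star_\lambda)$ is an associative conformal algebra. *)

(* Defs.v *)
From HB Require Import structures.
From mathcomp Require Import all_boot all_algebra finmap.
From mathcomp.multinomials Require Import monalg.

Set Implicit Arguments.
Unset Strict Implicit.
Unset Printing Implicit Defensive.

Import GRing.Theory.
Local Open Scope ring_scope.

(* A C[∂]-module is a left module over {poly C}, ∂ being the variable 'X.     *)
(* W[λ] is the type of finitely supported functions from exponents to W, and  *)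
(* W[λ, μ] is the same with pairs (exponent of λ, exponent of μ).             *)
Notation lpoly W := {malg W[nat]}.
Notation lmpoly W := {malg W[(nat * nat)%type]}.

Section FormalPolynomials.

Definition map_coef (I : choiceType) (U W : zmodType) (f : U -> W)
    (p : {malg U[I]}) : {malg W[I]} :=
  \sum_(i <- msupp p) << f p@_i *g i >>.

Definition map_expo (I J : choiceType) (W : zmodType) (h : I -> J)
    (p : {malg W[I]}) : {malg W[J]} :=
  \sum_(i <- msupp p) << p@_i *g h i >>.

(* λ p(λ) *)
Definition mul_lambda (W : zmodType) (p : lpoly W) : lpoly W :=
  map_expo S p.

(* p(λ + μ), by the binomial formula *)
Definition eval_lambdaDmu (W : zmodType) (p : lpoly W) : lmpoly W :=
  \sum_(n <- msupp p) \sum_(i < n.+1) << p@_n *+ 'C(n, i) *g (val i, n - i)%N >>.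

End FormalPolynomials.

Section ConformalMaps.

Variable K : fieldType.
Implicit Types U V W X Y Z : lmodType {poly K}.

Definition der W (w : W) : W := 'X *: w.

Record conformal_sesquilinear U V W (f : U -> V -> lpoly W) : Prop := {
  csl_addl : forall u u' v, f (u + u') v = f u v + f u' v;
  csl_addr : forall u v v', f u (v + v') = f u v + f u v';
  csl_scalel : forall (c : K) u v,
    f (c%:P *: u) v = map_coef (GRing.scale c%:P) (f u v);
  csl_scaler : forall (c : K) u v,
    f u (c%:P *: v) = map_coef (GRing.scale c%:P) (f u v);
  csl_derl : forall u v, f (der u) v = - mul_lambda (f u v);
  csl_derr : forall u v,
    f u (der v) = map_coef (@der W) (f u v) + mul_lambda (f u v)
}.

(* p(λ)_{λ+μ} w, where x_λ w := f x w; the λ^k of the coefficient p_k of p    *)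
(* multiplies (p_k)_{λ+μ} w.                                                  *)
Definition act_lambdaDmu X W Y (f : X -> W -> lpoly Y)
    (p : lpoly X) (w : W) : lmpoly Y :=
  \sum_(k <- msupp p)
    map_expo (fun ij : nat * nat => (k + ij.1, ij.2)%N)
             (eval_lambdaDmu (f p@_k w)).

(* u_λ q(μ), where u_λ z := f u z *)
Definition act_lambda U Z Y (f : U -> Z -> lpoly Y)
    (u : U) (q : lpoly Z) : lmpoly Y :=
  \sum_(j <- msupp q) map_expo (fun i : nat => (i, j)) (f u q@_j).

(* (u_λ v)_{λ+μ} w = u_λ (v_μ w), the four products being                     *)
(* uv : U x V -> X, xw : X x W -> Y, vw : V x W -> Z and uz : U x Z -> Y.     *)
Definition conformal_assoc U V W X Y Z
    (uv : U -> V -> lpoly X) (xw : X -> W -> lpoly Y)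
    (vw : V -> W -> lpoly Z) (uz : U -> Z -> lpoly Y) : Prop :=
  forall u v w, act_lambdaDmu xw (uv u v) w = act_lambda uz u (vw v w).

Record assoc_conformal_algebra (A : lmodType {poly K})
    (mul : A -> A -> lpoly A) : Prop := {
  aca_sesquilinear : conformal_sesquilinear mul;
  aca_assoc : conformal_assoc mul mul mul mul
}.

(* The left action a_λ m is l a m and the right action m_λ a is r m a.        *)
Record conformal_bimodule (A M : lmodType {poly K}) (mul : A -> A -> lpoly A)
    (l : A -> M -> lpoly M) (r : M -> A -> lpoly M) : Prop := {
  cbm_left_sesquilinear : conformal_sesquilinear l;
  cbm_right_sesquilinear : conformal_sesquilinear r;
  cbm_left : conformal_assoc mul l l l;
  cbm_right : conformal_assoc r r mul r;
  cbm_middle : conformal_assoc l r r l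
}.

Definition star (A M : lmodType {poly K})
    (l : A -> M -> lpoly M) (r : M -> A -> lpoly M) (T : M -> A)
    (m n : M) : lpoly M :=
  l (T m) n + r m (T n).

(* {linear M -> A} is the type of C[∂]-module homomorphisms.                  *)
Definition O_operator (A M : lmodType {poly K}) (mul : A -> A -> lpoly A)
    (l : A -> M -> lpoly M) (r : M -> A -> lpoly M)
    (T : {linear M -> A}) : Prop :=
  forall m n, mul (T m) (T n) = map_coef T (star l r T m n).

(* The actions m ·_λ a and a ·_λ m of (M, star) on A. *)
Definition induced_left (A M : lmodType {poly K}) (mul : A -> A -> lpoly A)
    (r : M -> A -> lpoly M) (T : M -> A) (m : M) (a : A) : lpoly A :=
  mul (T m) a - map_coef T (r m a).

Definition induced_right (A M : lmodType {poly K}) (mul : A -> A -> lpoly A)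
    (l : A -> M -> lpoly M) (T : M -> A) (a : A) (m : M) : lpoly A :=
  mul a (T m) - map_coef T (l a m).

End ConformalMaps.

(* Main.v *)
(* All the operations on λ-polynomials are additive and commute with T, so    *)
(* every conformal associativity required of the actions on A expands into     *)
(* instances of the axioms of A and M. The remaining terms cancel because of   *)
(* T(m)_λ T(p) = T(T(m)_λ p + m_λ T(p)) and its mirror image, which hold       *)
(* coefficientwise for M-valued polynomials p.                                 *)
Require Import Defs.
From HB Require Import structures.
From mathcomp Require Import all_boot all_algebra finmap reals.
From mathcomp.multinomials Require Import monalg.
From mathcomp.real_closed Require Import complex.

Import GRing.Theory.

Local Open Scope ring_scope.
Local Open Scope complex_scope.

(** Each associativity law for the induced actions is an identity in A[λ, μ], and one cancellation
    drives all three. Expanding m ·_λ (n ·_μ a) gives T(m)_λ (T(n)_μ a) - T(m)_λ T(n_μ a) - T(m_λ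
    (T(n)_μ a)) + T(m_λ T(n_μ a)). The second term is a product of two values of T, so the operator
    identity turns it into -T(T(m)_λ (n_μ a)) - T(m_λ T(n_μ a)), whose last part cancels the fourth
    term. The axioms of A and M, with T(m ⋆ n) = T(m)_λ T(n), identify what is left with the action
    of m ⋆_λ n on a. Here n_μ a is a polynomial, so [O_operator_act_lambda] and
    [O_operator_act_lambdaDmu] lift the operator identity to polynomial arguments; [raddf_subDB] is
    the cancellation. Sesquilinearity is inherited because the actions arise from the given ones by
    sums, negation and composition with the C[∂]-linear map T. *)

(** * Additivity of sums over the support of a polynomial *)

Section CoefficientwiseSums.

Context {I : choiceType} {U G : zmodType} {F : I -> U -> G}.
Hypothesis FD : forall i, {morph F i : x y / x + y}.

Let F0 i : F i 0 = 0.
Proof. by apply: (addrI (F i 0)); rewrite -FD !addr0. Qed.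

Lemma sum_msuppw (p : {malg U[I]}) (d : {fset I}) : (msupp p `<=` d)%fset ->
  \sum_(i <- msupp p) F i p@_i = \sum_(i <- d) F i p@_i.
Proof.
by move=> sub; apply: big_fset_incl => // i _ /mcoeff_outdom ->; rewrite F0.
Qed.

Lemma sum_msuppD :
  {morph (fun p : {malg U[I]} => \sum_(i <- msupp p) F i p@_i)
    : p q / p + q}.
Proof.
(* The three supports differ, so all sums are moved to the union of those of [p] and [q]. *)
move=> p q; rewrite (sum_msuppw _ _ (msuppD_le p q)).
rewrite (sum_msuppw p _ (fsubsetUl _ (msupp q))).
rewrite (sum_msuppw q _ (fsubsetUr (msupp p) _)) -big_split.
by apply: eq_bigr => i _; rewrite mcoeffD FD.
Qed.

Lemma sum_msuppU (i : I) (u : U) :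
  \sum_(j <- msupp << u *g i >>) F j << u *g i >>@_j = F i u.
Proof. by rewrite (sum_msuppw _ _ msuppU_le) big_seq_fset1 mcoeffUU. Qed.

End CoefficientwiseSums.

Lemma malg_additive_ext (I : choiceType) (U G : zmodType)
    (g h : {additive {malg U[I]} -> G}) :
  (forall (i : I) (u : U), g << u *g i >> = h << u *g i >>) -> g =1 h.
Proof.
move=> gh p; rewrite (monalgE p) !raddf_sum.
by apply: eq_bigr => i _; apply: gh.
Qed.

(** [additive] is phrased with subtraction, whereas the hypotheses met here preserve sums. *)
Lemma morphD_additive {U V : zmodType} (f : U -> V) :
  {morph f : x y / x + y} -> additive f.
Proof.
move=> fD; have f0 : f 0 = 0 by apply: (addrI (f 0)); rewrite -fD !addr0.
have fN y : f (- y) = - f y.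
  by apply/eqP; rewrite -addr_eq0 -fD addNr f0.
by move=> x y; rewrite fD fN.
Qed.

(** The cancellation closing every associativity proof: [y] is the term in which T is applied inside
    an action on M. *)
Lemma raddf_subDB (V W : zmodType) (f : {additive V -> W}) w x y z :
  w - f (x + y) - f (z - y) = w - f (x + z).
Proof. by rewrite -addrA -opprD -raddfD addrACA subrr addr0. Qed.

(** * The operations on λ-polynomials as additive maps *)

Section MapCoef.

Context {I : choiceType} {U W : zmodType} {f : {additive U -> W}}.

Let monoD (i : I) : {morph (fun u : U => << f u *g i >>) : x y / x + y}.
Proof. by move=> x y; rewrite raddfD monalgUD. Qed.

Lemma map_coef_is_additive : additive (@map_coef I U W f).
Proof. by apply: morphD_additive; exact: (sum_msuppD monoD). Qed.

HB.instance Definition _ := GRing.isAdditive.Build {malg U[I]} {malg W[I]}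
  (@map_coef I U W f) map_coef_is_additive.

Lemma map_coefU (i : I) u : map_coef f << u *g i >> = << f u *g i >>.
Proof. exact: (sum_msuppU monoD). Qed.

Lemma mcoeff_map_coef (p : {malg U[I]}) i : (map_coef f p)@_i = f p@_i.
Proof.
rewrite {2}(monalgE p) /map_coef !raddf_sum /=.
by apply: eq_bigr => j _; rewrite !mcoeffU raddfMn.
Qed.

Lemma sum_msupp_map_coef (G : zmodType) (F : I -> W -> G) (p : {malg U[I]}) :
  (forall i, {morph F i : x y / x + y}) ->
  \sum_(i <- msupp (map_coef f p)) F i (map_coef f p)@_i
    = \sum_(i <- msupp p) F i (f p@_i).
Proof.
(* [f] may kill coefficients, so the image can have smaller support than [p]. *)
move=> FD; rewrite (sum_msuppw FD _ (msupp p)).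
  by apply: eq_bigr => i _; rewrite mcoeff_map_coef.
apply/fsubsetP => i; rewrite -!mcoeff_neq0 mcoeff_map_coef.
by apply: contra_neq => ->; rewrite raddf0.
Qed.

End MapCoef.

Section MapExpo.

Context {I J : choiceType} {W : zmodType} {h : I -> J}.

Let monoD (i : I) : {morph (fun w : W => << w *g h i >>) : x y / x + y}.
Proof. by move=> x y; rewrite monalgUD. Qed.

Lemma map_expo_is_additive : additive (@map_expo I J W h).
Proof. by apply: morphD_additive; exact: (sum_msuppD monoD). Qed.

HB.instance Definition _ := GRing.isAdditive.Build {malg W[I]} {malg W[J]}
  (@map_expo I J W h) map_expo_is_additive.

Lemma map_expoU (i : I) (w : W) : map_expo h << w *g i >> = << w *g h i >>.
Proof. exact: (sum_msuppU monoD). Qed.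

End MapExpo.

Section EvalLambdaDmu.

Context {W : zmodType}.

Let monoD (n : nat) : {morph (fun w : W =>
  \sum_(i < n.+1) << w *+ 'C(n, i) *g (val i, n - i)%N >>) : x y / x + y}.
Proof.
move=> x y; rewrite -big_split; apply: eq_bigr => i _.
by rewrite mulrnDl monalgUD.
Qed.

Lemma eval_lambdaDmu_is_additive : additive (@eval_lambdaDmu W).
Proof. by apply: morphD_additive; exact: (sum_msuppD monoD). Qed.

HB.instance Definition _ := GRing.isAdditive.Build (lpoly W) (lmpoly W)
  (@eval_lambdaDmu W) eval_lambdaDmu_is_additive.

Lemma eval_lambdaDmuU n (w : W) : eval_lambdaDmu << w *g n >>
  = \sum_(i < n.+1) << w *+ 'C(n, i) *g (val i, n - i)%N >>.
Proof. exact: (sum_msuppU monoD). Qed.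

End EvalLambdaDmu.

HB.instance Definition _ (W : zmodType) :=
  GRing.Additive.copy (@mul_lambda W) (map_expo S).

HB.instance Definition _ (K : fieldType) (W : lmodType {poly K}) :=
  GRing.Additive.copy (@der K W) (GRing.scale 'X).

(** * Coefficient maps commute with changes of variables; by additivity monomials suffice *)

Section Naturality.

Context {U W : zmodType} (T : {additive U -> W}).

Lemma map_coef_map_expo {I J : choiceType} (h : I -> J) (p : {malg U[I]}) :
  map_coef T (map_expo h p) = map_expo h (map_coef T p).
Proof.
apply: (malg_additive_ext _ _ _ (map_coef T \o map_expo h)
                                (map_expo h \o map_coef T)) => i u /=.
by rewrite map_expoU !map_coefU map_expoU.
Qed.

Lemma map_coef_eval_lambdaDmu (p : lpoly U) :
  map_coef T (eval_lambdaDmu p) = eval_lambdaDmu (map_coef T p).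
Proof.
apply: (malg_additive_ext _ _ _ (map_coef T \o @eval_lambdaDmu U)
                                (@eval_lambdaDmu W \o map_coef T)) => n u /=.
rewrite map_coefU !eval_lambdaDmuU raddf_sum.
by apply: eq_bigr => i _; rewrite /= map_coefU raddfMn.
Qed.

End Naturality.

(** * Additivity and naturality of iterated actions *)

Section IteratedActions.

Context {K : fieldType}.
Implicit Types U V W X Y Z : lmodType {poly K}.

Definition left_additive {X W Y} (f : X -> W -> lpoly Y) :=
  forall w, {morph f^~ w : x y / x + y}.

Definition right_additive {X W Y} (f : X -> W -> lpoly Y) :=
  forall x, {morph f x : v w / v + w}.

Section LambdaDmu.

Context {X W Y} (f : X -> W -> lpoly Y).

Lemma act_lambdaDmuDf (g : X -> W -> lpoly Y) p w :
  act_lambdaDmu (fun x w => f x w + g x w) p w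
    = act_lambdaDmu f p w + act_lambdaDmu g p w.
Proof.
by rewrite -big_split; apply: eq_bigr => k _; rewrite !raddfD.
Qed.

Lemma act_lambdaDmuBf (g : X -> W -> lpoly Y) p w :
  act_lambdaDmu (fun x w => f x w - g x w) p w
    = act_lambdaDmu f p w - act_lambdaDmu g p w.
Proof.
by rewrite -sumrB; apply: eq_bigr => k _; rewrite !raddfB.
Qed.

Lemma act_lambdaDmu_map_coef Y' (T : {additive Y -> Y'}) p w :
  act_lambdaDmu (fun x w => map_coef T (f x w)) p w
    = map_coef T (act_lambdaDmu f p w).
Proof.
rewrite raddf_sum; apply: eq_bigr => k _ /=.
by rewrite map_coef_map_expo map_coef_eval_lambdaDmu.
Qed.

Hypothesis fD : left_additive f.

Let termD w k : {morph (fun x => map_expo (fun ij : nat * nat =>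
  (k + ij.1, ij.2)%N) (eval_lambdaDmu (f x w))) : x y / x + y}.
Proof. by move=> x y; rewrite fD !raddfD. Qed.

Lemma act_lambdaDmuDl p q w :
  act_lambdaDmu f (p + q) w = act_lambdaDmu f p w + act_lambdaDmu f q w.
Proof. exact: (sum_msuppD (termD w)). Qed.

Lemma act_lambdaDmuBl p q w :
  act_lambdaDmu f (p - q) w = act_lambdaDmu f p w - act_lambdaDmu f q w.
Proof. exact: (morphD_additive _ (sum_msuppD (termD w))). Qed.

(** Trades a map on coefficients for a precomposed action, the form in which the operator identity
    applies termwise. *)
Lemma act_lambdaDmu_pull X' (T : {additive X' -> X}) p w :
  act_lambdaDmu f (map_coef T p) w = act_lambdaDmu (fun x => f (T x)) p w.
Proof. exact: (sum_msupp_map_coef _ _ _ (termD w)). Qed.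

End LambdaDmu.

Section Lambda.

Context {U Z Y} (f : U -> Z -> lpoly Y).

Lemma act_lambdaDf (g : U -> Z -> lpoly Y) u q :
  act_lambda (fun u z => f u z + g u z) u q
    = act_lambda f u q + act_lambda g u q.
Proof.
by rewrite -big_split; apply: eq_bigr => k _; rewrite !raddfD.
Qed.

Lemma act_lambdaBf (g : U -> Z -> lpoly Y) u q :
  act_lambda (fun u z => f u z - g u z) u q
    = act_lambda f u q - act_lambda g u q.
Proof.
by rewrite -sumrB; apply: eq_bigr => k _; rewrite !raddfB.
Qed.

Lemma act_lambda_map_coef Y' (T : {additive Y -> Y'}) u q :
  act_lambda (fun u z => map_coef T (f u z)) u q
    = map_coef T (act_lambda f u q).
Proof.
by rewrite raddf_sum; apply: eq_bigr => k _ /=; rewrite map_coef_map_expo.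
Qed.

Hypothesis fD : right_additive f.

Let termD u (j : nat) :
  {morph (fun z => map_expo (fun i : nat => (i, j)) (f u z)) : x y / x + y}.
Proof. by move=> x y; rewrite fD !raddfD. Qed.

Lemma act_lambdaDr u p q :
  act_lambda f u (p + q) = act_lambda f u p + act_lambda f u q.
Proof. exact: (sum_msuppD (termD u)). Qed.

Lemma act_lambdaBr u p q :
  act_lambda f u (p - q) = act_lambda f u p - act_lambda f u q.
Proof. exact: (morphD_additive _ (sum_msuppD (termD u))). Qed.

Lemma act_lambda_pull Z' (T : {additive Z' -> Z}) u q :
  act_lambda f u (map_coef T q) = act_lambda (fun u z => f u (T z)) u q.
Proof. exact: (sum_msupp_map_coef _ _ _ (termD u)). Qed.

End Lambda.

(** * Closure properties of sesquilinear maps *)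

Section Sesquilinear.

Context {U V W : lmodType {poly K}}.
Implicit Types f g : U -> V -> lpoly W.

Lemma conformal_sesquilinearD f g :
  conformal_sesquilinear f -> conformal_sesquilinear g ->
  conformal_sesquilinear (fun u v => f u v + g u v).
Proof.
case=> f1 f2 f3 f4 f5 f6 [g1 g2 g3 g4 g5 g6]; split=> *.
- by rewrite f1 g1 addrACA.
- by rewrite f2 g2 addrACA.
- by rewrite f3 g3 raddfD.
- by rewrite f4 g4 raddfD.
- by rewrite f5 g5 !raddfD.
- by rewrite f6 g6 !raddfD addrACA.
Qed.

Lemma conformal_sesquilinearN f :
  conformal_sesquilinear f -> conformal_sesquilinear (fun u v => - f u v).
Proof.
case=> f1 f2 f3 f4 f5 f6; split=> *.
- by rewrite f1 opprD.
- by rewrite f2 opprD.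
- by rewrite f3 raddfN.
- by rewrite f4 raddfN.
- by rewrite f5 !raddfN.
- by rewrite f6 !raddfN opprD.
Qed.

Lemma conformal_sesquilinear_precompl U' (T : {linear U' -> U}) f :
  conformal_sesquilinear f -> conformal_sesquilinear (fun u v => f (T u) v).
Proof.
case=> f1 f2 f3 f4 f5 f6; split=> *.
- by rewrite raddfD f1.
- by rewrite f2.
- by rewrite linearZ f3.
- by rewrite f4.
- by rewrite /der linearZ -/(der _) f5.
- by rewrite f6.
Qed.

Lemma conformal_sesquilinear_precompr V' (T : {linear V' -> V}) f :
  conformal_sesquilinear f -> conformal_sesquilinear (fun u v => f u (T v)).
Proof.
case=> f1 f2 f3 f4 f5 f6; split=> *.
- by rewrite f1.
- by rewrite raddfD f2.
- by rewrite f3.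
- by rewrite linearZ f4.
- by rewrite f5.
- by rewrite /der linearZ -/(der _) f6.
Qed.

(** With [c] equal to ['X] this says that T commutes with ∂ on coefficients. *)
Lemma map_coef_scale {I : choiceType} W' (T : {linear W -> W'}) c
    (p : {malg W[I]}) :
  map_coef T (map_coef (GRing.scale c) p)
    = map_coef (GRing.scale c) (map_coef T p).
Proof. by apply/malgP => i; rewrite !mcoeff_map_coef /= linearZ. Qed.

Lemma conformal_sesquilinear_postcomp W' (T : {linear W -> W'}) f :
  conformal_sesquilinear f ->
  conformal_sesquilinear (fun u v => map_coef T (f u v)).
Proof.
case=> f1 f2 f3 f4 f5 f6; split=> *.
- by rewrite f1 raddfD.
- by rewrite f2 raddfD.
- by rewrite f3 map_coef_scale.
- by rewrite f4 map_coef_scale.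
- by rewrite f5 raddfN /= map_coef_map_expo.
- by rewrite f6 raddfD /= map_coef_scale map_coef_map_expo.
Qed.

Lemma conformal_sesquilinear_left_additive f :
  conformal_sesquilinear f -> left_additive f.
Proof. by move=> fS w x y; apply: csl_addl. Qed.

Lemma conformal_sesquilinear_right_additive f :
  conformal_sesquilinear f -> right_additive f.
Proof. by move=> fS w x y; apply: csl_addr. Qed.

End Sesquilinear.

End IteratedActions.

(** * The algebra on M and its bimodule A *)

Section OOperator.

Context {K : fieldType} {A M : lmodType {poly K}}.
Context {mul : A -> A -> lpoly A}.
Context {l : A -> M -> lpoly M} {r : M -> A -> lpoly M}.
Context {T : {linear M -> A}}.

Hypothesis mulP : assoc_conformal_algebra mul.
Hypothesis lrP : conformal_bimodule mul l r.
Hypothesis TP : O_operator mul l r T.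

Let mulS := aca_sesquilinear mulP.
Let lS := cbm_left_sesquilinear lrP.
Let rS := cbm_right_sesquilinear lrP.

Let mulDl := conformal_sesquilinear_left_additive _ mulS.
Let mulDr := conformal_sesquilinear_right_additive _ mulS.
Let lDl := conformal_sesquilinear_left_additive _ lS.
Let lDr := conformal_sesquilinear_right_additive _ lS.
Let rDl := conformal_sesquilinear_left_additive _ rS.
Let rDr := conformal_sesquilinear_right_additive _ rS.

Lemma star_sesquilinear : conformal_sesquilinear (star l r T).
Proof.
by apply: conformal_sesquilinearD;
  [apply: conformal_sesquilinear_precompl
  |apply: conformal_sesquilinear_precompr].
Qed.

Lemma induced_left_sesquilinear :
  conformal_sesquilinear (induced_left mul r T).
Proof.
apply: conformal_sesquilinearD; first exact: conformal_sesquilinear_precompl.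
by apply: conformal_sesquilinearN; apply: conformal_sesquilinear_postcomp.
Qed.

Lemma induced_right_sesquilinear :
  conformal_sesquilinear (induced_right mul l T).
Proof.
apply: conformal_sesquilinearD; first exact: conformal_sesquilinear_precompr.
by apply: conformal_sesquilinearN; apply: conformal_sesquilinear_postcomp.
Qed.

Lemma act_lambda_star m q : act_lambda (star l r T) m q
  = act_lambda l (T m) q + act_lambda r m (map_coef T q).
Proof. by rewrite act_lambdaDf (act_lambda_pull r). Qed.

Lemma act_lambdaDmu_star p n : act_lambdaDmu (star l r T) p n
  = act_lambdaDmu l (map_coef T p) n + act_lambdaDmu r p (T n).
Proof. by rewrite act_lambdaDmuDf (act_lambdaDmu_pull l). Qed.

Lemma act_lambda_induced_left m q : act_lambda (induced_left mul r T) m q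
  = act_lambda mul (T m) q - map_coef T (act_lambda r m q).
Proof. by rewrite act_lambdaBf act_lambda_map_coef. Qed.

Lemma act_lambdaDmu_induced_left p a :
  act_lambdaDmu (induced_left mul r T) p a
  = act_lambdaDmu mul (map_coef T p) a - map_coef T (act_lambdaDmu r p a).
Proof.
by rewrite act_lambdaDmuBf act_lambdaDmu_map_coef (act_lambdaDmu_pull mul).
Qed.

Lemma act_lambda_induced_right a q : act_lambda (induced_right mul l T) a q
  = act_lambda mul a (map_coef T q) - map_coef T (act_lambda l a q).
Proof. by rewrite act_lambdaBf act_lambda_map_coef (act_lambda_pull mul). Qed.

Lemma act_lambdaDmu_induced_right p m :
  act_lambdaDmu (induced_right mul l T) p m
  = act_lambdaDmu mul p (T m) - map_coef T (act_lambdaDmu l p m).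
Proof. by rewrite act_lambdaDmuBf act_lambdaDmu_map_coef. Qed.

Lemma O_operator_act_lambda m q : act_lambda mul (T m) (map_coef T q)
  = map_coef T (act_lambda l (T m) q + act_lambda r m (map_coef T q)).
Proof.
rewrite -act_lambda_star -act_lambda_map_coef (act_lambda_pull mul) //.
by apply: eq_bigr => j _; rewrite TP.
Qed.

Lemma O_operator_act_lambdaDmu p n : act_lambdaDmu mul (map_coef T p) (T n)
  = map_coef T (act_lambdaDmu l (map_coef T p) n + act_lambdaDmu r p (T n)).
Proof.
rewrite -act_lambdaDmu_star -(act_lambdaDmu_map_coef (star l r T) _ T).
rewrite (act_lambdaDmu_pull mul mulDl _ T).
by apply: eq_bigr => j _; rewrite TP.
Qed.

(** Since T(m ⋆ n) = T(m)_λ T(n), both sides split into three terms, matched one by one by the left,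
    middle and right bimodule laws. *)
Lemma star_assoc_conformal_algebra : assoc_conformal_algebra (star l r T).
Proof.
split; first exact: star_sesquilinear.
move=> m n p; rewrite act_lambdaDmu_star act_lambda_star -!TP.
rewrite act_lambdaDmuDl // act_lambdaDr // (cbm_left lrP) (cbm_middle lrP).
by rewrite (cbm_right lrP) addrA.
Qed.

Lemma induced_conformal_bimodule : conformal_bimodule (star l r T)
  (induced_left mul r T) (induced_right mul l T).
Proof.
split; [exact: induced_left_sesquilinear|exact: induced_right_sesquilinear|..].
- move=> m n a; rewrite act_lambdaDmu_induced_left act_lambda_induced_left -TP.
  rewrite (act_lambdaDmuDl r rDl) (act_lambdaBr mul mulDr).
  rewrite (act_lambdaBr r rDr) O_operator_act_lambda.
  rewrite (aca_assoc mulP) (cbm_middle lrP) (cbm_right lrP).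
  (* The cancelled term is m_λ T(n_μ a). *)
  by rewrite [RHS]raddf_subDB.
- move=> a m n; rewrite act_lambdaDmu_induced_right act_lambda_induced_right.
  rewrite -TP (act_lambdaDr l lDr) (act_lambdaDmuBl mul mulDl).
  rewrite (act_lambdaDmuBl l lDl) O_operator_act_lambdaDmu.
  rewrite (aca_assoc mulP) (cbm_middle lrP) (cbm_left lrP).
  (* The mirror case: T(a_λ m)_{λ+μ} n cancels, once moved to the end of its sum. *)
  rewrite (addrC (act_lambdaDmu l _ n)) [LHS]raddf_subDB /=.
  by rewrite (addrC (act_lambda l a (r m _))).
- move=> m a n; rewrite act_lambdaDmu_induced_right act_lambda_induced_left.
  rewrite (act_lambdaBr mul mulDr) (act_lambdaBr r rDr) O_operator_act_lambda.
  rewrite (act_lambdaDmuBl mul mulDl) (act_lambdaDmuBl l lDl).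
  rewrite O_operator_act_lambdaDmu.
  rewrite (aca_assoc mulP) (cbm_right lrP) (cbm_left lrP).
  (* In the middle law both sides have a cancellation: m_λ T(a_μ n) on the right, T(m_λ a)_{λ+μ} n
     on the left. *)
  rewrite [RHS]raddf_subDB (addrC (act_lambdaDmu l _ n)) [LHS]raddf_subDB /=.
  by rewrite (addrC (act_lambda l (T m) _)).
Qed.

End OOperator.

Theorem lemma3p7 (R : realType) (A M : lmodType {poly R[i]})
  (mul : A -> A -> lpoly A)
  (l : A -> M -> lpoly M) (r : M -> A -> lpoly M)
  (T : {linear M -> A}) :
  assoc_conformal_algebra mul ->
  conformal_bimodule mul l r ->
  O_operator mul l r T ->
  assoc_conformal_algebra (star l r T) /\
  conformal_bimodule (star l r T)
    (induced_left mul r T) (induced_right mul l T).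
Proof.
move=> mulP lrP TP; split; first exact: star_assoc_conformal_algebra lrP TP.
exact: induced_conformal_bimodule mulP lrP TP.
Qed.
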